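(* Let $p$ be a prime number, $F$ a field of characteristic $p$, $X$ an indeterminate over $F$, $D_n=F[X^{\frac{1}{p^n}},X^{-\frac{1}{p^n}}]$ for each $n\in\mathbb{N}_0$ and $D=\bigcup_{n\in\mathbb{N}_0}D_n$. For $n\in\mathbb{N}_0$, let $f(X^{\frac{1}{p^{n+1}}})\in F[X^{\frac{1}{p^{n+1}}}]$ be a nonconstant polynomial with $f(0)\neq 0$. Then the following statements are satisfied. (1) $f(X^{\frac{1}{p^{n+1}}})^p\in D_n$. (2) If $f(X^{\frac{1}{p^{n+1}}})\notin D_n$, then $f(X^{\frac{1}{p^{n+1}}})$ is irreducible in $D_{n+1}$ if and only if $f(X^{\frac{1}{p^{n+1}}})^p$ is irreducible in $D_n$. (3) Suppose $F$ is an algebraic extension of $\mathbb{Z}/p\mathbb{Z}$. Then each nonzero nonunit of $D_n$ is not irreducible in $D_{n+1}$. In particular, $D$ has no irreducible element. (4) $F$ is finite if and only if every residue field of $D$ is finite.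
   Context: $\mathbb{N}_0$ is the set of nonnegative integers. The elements $X^{1/p^n}$ are compatible roots of $X$, i.e. $(X^{1/p^{n+1}})^p=X^{1/p^n}$, so $D_n\subsetneq D_{n+1}$. The condition $f(0)\neq0$ means that the constant term of $f$ is nonzero. A residue field of $D$ is a field $D/M$ with $M$ a maximal ideal of $D$. *)

(* Defs.v *)
From HB Require Import structures.
From mathcomp Require Import all_boot all_order all_algebra.
From mathcomp Require Import ring_quotient.
From mathcomp Require Import boolp classical_sets functions cardinality.

Set Implicit Arguments.
Unset Strict Implicit.
Unset Printing Implicit Defensive.

Import GRing.Theory.
Local Open Scope ring_scope.

(* Units and irreducible elements of a subring S of K: invertibility and
   factorizations are taken inside S, not inside K. *)
Definition unit_in (K : comNzRingType) (S : {pred K}) (a : K) : Prop :=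
  a \in S /\ exists2 b, b \in S & a * b = 1.

Definition irreducible_in (K : comNzRingType) (S : {pred K}) (a : K) : Prop :=
  [/\ a \in S, a != 0, ~ unit_in S a &
      forall b c, b \in S -> c \in S -> a = b * c ->
        unit_in S b \/ unit_in S c].

(* Elements of idealr R are proper ideals, and {ideal_quot M} is R / M. *)
Definition maximal_ideal (R : comNzRingType) (M : idealr R) : Prop :=
  forall I : idealr R, {subset M <= I} -> {subset I <= M}.

(* The canonical map Z/pZ -> F; it is a ring morphism when p is the
   characteristic of F. *)
Definition Fp_to (p : nat) (F : nzRingType) (c : 'F_p) : F := (c : nat)%:R.

Definition algebraic_over_Fp (p : nat) (F : fieldType) : Prop :=
  forall a : F, algebraicOver (@Fp_to p F) a.

(* The ring F[u, u^-1] inside K, for u != 0: its elements are the quotients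
   g(u) / u^k with g a polynomial over F. *)
Definition laurent (F K : fieldType) (iota : {rmorphism F -> K}) (u : K) :
    {pred K} :=
  fun v => `[< exists (g : {poly F}) (k : nat),
                 v = (map_poly iota g).[u] / u ^+ k >].

(* The indeterminate X over F together with a compatible system of roots
   X^(1/p^n), living in an extension field K of F: tower_root n is X^(1/p^n), and
   X is an indeterminate in that tower_root 0 is transcendental over F. *)
Record root_tower (p : nat) (F K : fieldType) (iota : {rmorphism F -> K}) :=
  RootTower {
    tower_root :> nat -> K;
    tower_transcendental : ~ algebraicOver iota (tower_root 0);
    tower_rootX : forall n, tower_root n.+1 ^+ p = tower_root n
  }.

Section Rings.
Variables (p : nat) (F K : fieldType) (iota : {rmorphism F -> K}).
Variable X : root_tower p iota.

Definition Dn (n : nat) : {pred K} := laurent iota (X n).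

Definition Dunion : {pred K} := fun v => `[< exists n, v \in Dn n >].

Lemma tower_root_transc n : ~ algebraicOver iota (X n).
Proof.
elim: n => [|n IHn]; first exact: tower_transcendental.
move=> alg; apply: IHn; rewrite -tower_rootX; move: (X n.+1) alg => u alg.
elim: p => [|k IHk]; first exact: algebraic1.
by rewrite exprS; exact: algebraic_mul.
Qed.

Lemma tower_root_neq0 n : X n != 0.
Proof.
by apply/eqP=> X0; apply: (@tower_root_transc n); rewrite X0; exact: algebraic0.
Qed.

Lemma Dn_subring n : subring_closed (Dn n).
Proof.
have xk k : X n ^+ k != 0 by rewrite expf_neq0 ?tower_root_neq0.
split.
- by apply/asboolP; exists 1, 0; rewrite rmorph1 hornerC expr0 divr1.
- move=> _ _ /asboolP[g [k ->]] /asboolP[h [l ->]]; apply/asboolP.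
  exists (g * 'X^l - h * 'X^k), (k + l)%N.
  rewrite rmorphB !rmorphM /= !map_polyXn hornerD hornerN !hornerM !hornerXn.
  by rewrite mulrBl exprD -mulf_div divff // mulr1 [X n ^+ k * _]mulrC
             -mulf_div divff // mulr1.
- move=> _ _ /asboolP[g [k ->]] /asboolP[h [l ->]]; apply/asboolP.
  by exists (g * h), (k + l)%N; rewrite rmorphM hornerM exprD mulf_div.
Qed.

Lemma Dn_mono m n : (m <= n)%N -> {subset Dn m <= Dn n}.
Proof.
move=> /subnKC <-; elim: (n - m)%N => [|d IHd] v; first by rewrite addn0.
move=> /IHd; rewrite addnS => /asboolP[g [k ->]]; apply/asboolP.
exists (g \Po 'X^p), (p * k)%N.
by rewrite map_comp_poly map_polyXn horner_comp hornerXn exprM !tower_rootX.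
Qed.

Lemma Dunion_subring : subring_closed Dunion.
Proof.
have two u v : u \in Dunion -> v \in Dunion ->
    exists n, u \in Dn n /\ v \in Dn n.
  move=> /asboolP[m um] /asboolP[n vn]; exists (maxn m n).
  by split; [apply: (Dn_mono (leq_maxl m n)) | apply: (Dn_mono (leq_maxr m n))].
split.
- by apply/asboolP; exists 0%N; case: (Dn_subring 0).
- move=> u v uD vD; have [n [un vn]] := two _ _ uD vD.
  by apply/asboolP; exists n; case: (Dn_subring n) => _ + _; apply.
- move=> u v uD vD; have [n [un vn]] := two _ _ uD vD.
  by apply/asboolP; exists n; case: (Dn_subring n) => _ _; apply.
Qed.

HB.instance Definition _ := GRing.isSubringClosed.Build K Dunion Dunion_subring.

(* The subset Dunion as a ring in its own right, needed to form quotients. *)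
Record Dring := MkDring { Dring_val :> K; _ : Dring_val \in Dunion }.

HB.instance Definition _ := [isSub for Dring_val].
HB.instance Definition _ := [Choice of Dring by <:].
HB.instance Definition _ := [SubChoice_isSubComNzRing of Dring by <:].

End Rings.

(* Main.v *)
(** The Frobenius map sends D_(n+1) into D_n, which gives (1) and transports
    units and factorizations downwards. In (2), a factorization of f^p over D_n
    has, by unique factorization in F[X^(1/p^(n+1))], factors that are monomials
    times powers f^i; since f^i is then a polynomial in X^(1/p^n), its derivative
    vanishes, so i is 0 or p unless f itself lies in D_n. In (3), an element
    algebraic over Z/pZ has finitely many powers, so it is a p-th power; hence F
    is perfect and every element of D_n is a p-th power in D_(n+1).

    For (4), let F be finite and M a maximal ideal. M contains a nonzero
    polynomial in X, so F[X] has a finite image E in D/M. That image contains the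
    inverse of the class of X, and every element of D/M has some p^m-th power in
    E. As D/M is reduced, Frobenius permutes E and is injective on D/M, so
    E = D/M. Conversely, F embeds in the residue field of D at the kernel of the
    evaluation X^(1/p^n) = 1. *)
From HB Require Import structures.
Require Import Defs.
From mathcomp Require Import all_boot all_order all_algebra.
From mathcomp Require Import ring_quotient.
From mathcomp Require Import boolp classical_sets functions cardinality.

Set Implicit Arguments.
Unset Strict Implicit.
Unset Printing Implicit Defensive.

Import GRing.Theory.
Local Open Scope classical_set_scope.
Local Open Scope ring_scope.

(** * Finite sets of powers, and the Frobenius map on them *)

Lemma finite_pigeonhole (T : Type) (E : set T) (s : nat -> T) :
  finite_set E -> (forall i, E (s i)) -> exists i j, (i < j)%N /\ s i = s j.
Proof.
move=> finE Es; apply: contrapT => s_neq; apply: infinite_nat.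
have -> : [set: nat] = s @^-1` E by apply/seteqP; split=> i //= _; exact: Es.
apply: finite_preimage finE => i j _ _ eq_s.
by case: (ltngtP i j) => // lt_ij; case: s_neq; [exists i, j | exists j, i].
Qed.

(** Two powers [x ^+ i] and [x ^+ j] with [i < j] coincide; multiplying by [z ^+ i] gives
    [x ^+ (j - i) = 1], so [z] is the power one below. *)
Lemma finite_unit_inv (R : comNzRingType) (E : set R) (x z : R) :
  finite_set E -> (forall i, E (x ^+ i)) -> z * x = 1 ->
  exists i, z = x ^+ i.
Proof.
move=> finE Ex zx1; have [i [j [lt_ij]]] := finite_pigeonhole finE Ex.
have zxk k : z ^+ k * x ^+ k = 1 by rewrite -exprMn zx1 expr1n.
move=> /(congr1 ( *%R (z ^+ i))); rewrite zxk -(subnKC lt_ij) addSnnS exprD.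
by rewrite mulrA zxk mul1r exprS => xk1; exists (j - i.+1)%N;
   rewrite -[LHS]mulr1 xk1 mulrA zx1 mul1r.
Qed.

Lemma iter_expr (R : nzRingType) (p m : nat) (x : R) :
  iter m (fun y => y ^+ p) x = x ^+ (p ^ m).
Proof. by elim: m => //= m ->; rewrite -exprM -expnSr. Qed.

Lemma inj_exprXn (R : nzRingType) (p m : nat) :
  injective (fun x : R => x ^+ p) -> injective (fun x : R => x ^+ (p ^ m)).
Proof.
move=> injp x y; rewrite -!iter_expr; elim: m => //= m IHm.
by move=> /injp.
Qed.

(** Pigeonhole gives a repetition among the iterated Frobenius images of [x]; injectivity pulls it
    back to [x] itself. *)
Lemma finite_Frobenius_period (R : nzRingType) (p : nat) (E : set R) (x : R) :
  injective (fun x : R => x ^+ p) -> finite_set E -> (forall i, E (x ^+ i)) ->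
  exists k, x ^+ (p ^ k.+1) = x.
Proof.
move=> injp finE Ex.
have [i [j [lt_ij eq_x]]] :=
  finite_pigeonhole (s := fun i => x ^+ (p ^ i)) finE (fun i => Ex _).
exists (j - i.+1)%N; apply: (inj_exprXn (m := i) injp) => /=.
by rewrite eq_x -exprM -expnD subnSK // subnK // ltnW.
Qed.

(* Frobenius permutes the powers of [x], so its inverse is a power of it. *)
Lemma finite_Frobenius_root (R : nzRingType) (p m : nat) (E : set R) (x v : R) :
  injective (fun x : R => x ^+ p) -> finite_set E -> (forall i, E (x ^+ i)) ->
  v ^+ (p ^ m) = x -> exists i, v = x ^+ i.
Proof.
move=> injp finE Ex vx.
have [k xk] := finite_Frobenius_period injp finE Ex.
have xkm l : x = x ^+ (p ^ (k.+1 * l)).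
  elim: l => [|l IHl]; first by rewrite muln0.
  by rewrite mulnS expnD exprM xk.
(* Frobenius has period [k.+1] on [x], so [k * m] further steps undo [m] steps: together they make
   [k.+1 * m]. *)
exists (p ^ (k * m))%N; apply: (inj_exprXn (m := m) injp) => /=.
by rewrite vx [LHS](xkm m) -exprM -expnD mulSn addnC.
Qed.

Lemma finite_poly_size (A : nzRingType) (d : nat) :
  finite_set [set: A] -> finite_set [set q : {poly A} | (size q <= d)%N].
Proof.
move=> finA; elim: d => [|d IHd].
  apply: sub_finite_set (finite_set1 0) => q.
  by rewrite /= leqn0 size_poly_eq0 => /eqP.
apply: sub_finite_set (finite_image2 (fun c q => q * 'X + c%:P) finA IHd).
move=> q /= szq.
exists q`_0 => //; exists (drop_poly 1 q).
  by rewrite /= size_drop_poly leq_subLR add1n.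
apply/polyP=> i; rewrite coefD coefMX coefC coef_drop_poly.
by case: i => [|i] //=; rewrite ?add0r // addr0 addn1.
Qed.

(** Modulo [g], every polynomial has the same image as its remainder, and there are finitely many
    remainders. *)
Lemma finite_range_poly (A : fieldType) (R : nzRingType)
    (psi : {rmorphism {poly A} -> R}) (g : {poly A}) :
  finite_set [set: A] -> g != 0 -> psi g = 0 -> finite_set (range psi).
Proof.
move=> finA g0 psig.
apply: sub_finite_set (finite_image psi (finite_poly_size (size g) finA)).
move=> _ [q _ <-]; exists (q %% g); first exact/ltnW/ltn_modpN0.
by rewrite [in RHS](divp_eq q g) rmorphD rmorphM /= psig mulr0 add0r.
Qed.

Lemma Frobenius_inj (R : comNzRingType) (p : nat) :
  p \in [pchar R] -> (forall x : R, x ^+ p = 0 -> x = 0) ->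
  injective (fun x : R => x ^+ p).
Proof.
move=> pR reduced x y /= eq_xy; apply/eqP; rewrite -subr_eq0; apply/eqP.
apply: reduced; rewrite -(pFrobenius_autE pR) rmorphB /= !pFrobenius_autE.
by rewrite eq_xy subrr.
Qed.

(** * Elements algebraic over the prime field are p-th powers *)

Section Perfect.
Variables (p : nat) (F : fieldType).
Hypothesis pF : p \in [pchar F].

Let val_Fp n : ((inZp n : 'F_p) : nat)%:R = n%:R :> F.
Proof. by rewrite /= (Fp_cast (pcharf_prime pF)) GRing.natr_mod_pchar. Qed.

Lemma Fp_to_zmod_morphism : zmod_morphism (@Fp_to p F).
Proof.
move=> a b; apply: (addIr (Fp_to F b)); rewrite subrK.
by rewrite -[in RHS](subrK b a) /Fp_to -natrD; apply/esym/val_Fp.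
Qed.

Lemma Fp_to_monoid_morphism : monoid_morphism (@Fp_to p F).
Proof.
split=> [|a b]; rewrite /Fp_to; first exact: (val_Fp 1).
by rewrite -natrM; exact: val_Fp.
Qed.

HB.instance Definition _ :=
  GRing.isZmodMorphism.Build 'F_p F (@Fp_to p F) Fp_to_zmod_morphism.
HB.instance Definition _ :=
  GRing.isMonoidMorphism.Build 'F_p F (@Fp_to p F) Fp_to_monoid_morphism.

Lemma algebraic_over_Fp_perfect (a : F) :
  algebraicOver (@Fp_to p F) a -> exists b, b ^+ p = a.
Proof.
case=> q q0 /rootP qa.
pose psi : {rmorphism {poly 'F_p} -> F} :=
  horner_eval a \o map_poly (@Fp_to p F).
(* The range of [psi] is the ring generated by [a] over the prime field; the relation [q] makes it
   finite. *)
have fin : finite_set (range psi).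
  by apply: (@finite_range_poly _ _ psi q _ q0 qa); exact: finite_finset.
have Ea i : range psi (a ^+ i).
  by exists 'X^i => //; rewrite /= /horner_eval map_polyXn hornerXn.
have injF : injective (fun x : F => x ^+ p).
  by apply: (Frobenius_inj pF) => x /eqP; rewrite expf_eq0 => /andP[_ /eqP].
have [k ak] := finite_Frobenius_period injF fin Ea.
by exists (a ^+ (p ^ k)); rewrite -exprM -expnSr.
Qed.

End Perfect.

(** * Factors of powers and vanishing derivatives of polynomials *)

(** Induction on [m]: the irreducible [f] divides [a], or is coprime to [a] and divides [b]; one
    factor [f] is cancelled either way. *)
Lemma irreducible_dvd_exp (F : fieldType) (f a b : {poly F}) (m : nat) :
  irreducible_poly f -> a * b = f ^+ m ->
  exists i c, [/\ (i <= m)%N, c != 0 & a = c *: f ^+ i].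
Proof.
move=> irr_f; have f0 := irredp_neq0 irr_f.
elim: m a b => [|m IHm] a b ab.
  have : a %| 1 by rewrite -(expr0 f) -ab dvdp_mulIl.
  rewrite dvdp1 => /size_poly1P[c c0 ->].
  by exists 0%N, c; rewrite expr0 alg_polyC.
have : f %| a * b by rewrite ab exprS dvdp_mulIl.
have [/dvdpP[a' aE]|fNa] := boolP (f %| a).
  move=> _; have [|i [c [le_im c0 a'E]]] := IHm a' b.
    by apply: (mulfI f0); rewrite -exprS -ab aE mulrCA mulrA.
  by exists i.+1, c; rewrite aE a'E exprSr scalerAl.
rewrite Gauss_dvdpr ?irreducible_poly_coprime // => /dvdpP[b' bE].
have [|i [c [le_im c0 ->]]] := IHm a b'.
  by apply: (mulfI f0); rewrite -exprS -ab bE mulrCA [b' * f]mulrC.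
by exists i, c; rewrite leqW.
Qed.

Lemma mulXn_inj (F : fieldType) (a b : {poly F}) (i j : nat) :
  ~~ root a 0 -> ~~ root b 0 -> a * 'X^i = b * 'X^j -> a = b.
Proof.
wlog le_ij : a b i j / (i <= j)%N.
  by move=> W ra rb; case: (leqP i j) => [|/ltnW] le ab; [|apply/esym];
     exact: W le _ _ _.
move=> ra _ /eqP; rewrite -(subnK le_ij) exprD mulrA -subr_eq0 -mulrBl.
rewrite mulf_eq0 expf_eq0 polyX_eq0 andbF orbF subr_eq0 => /eqP aE.
(* A positive difference of exponents would make [a] vanish at 0. *)
case: (j - i)%N aE => [|k aE]; first by rewrite mulr1.
by move: ra; rewrite aE rootE hornerM hornerXn expr0n mulr0 eqxx.
Qed.

(** The coefficients of the derivative are [i * f_i], so [f_i] vanishes unless p divides [i]. The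
    bound [size f] is generous; the extra coefficients are 0. *)
Lemma deriv_eq0_comp_Xn (F : fieldType) (p : nat) (f : {poly F}) :
  p \in [pchar F] -> f^`() = 0 ->
  f = (\poly_(i < size f) f`_(i * p)) \Po 'X^p.
Proof.
move=> pF f'0; have p0 := prime_gt0 (pcharf_prime pF).
apply/polyP=> i; rewrite coef_comp_poly_Xn // coef_poly.
have [/dvdnP[k ->]|pNi] := boolP (p %| i)%N.
  rewrite mulnK //; case: ltnP => // szk.
  by rewrite nth_default // (leq_trans szk) // leq_pmulr.
case: i pNi => [|i] pNi; first by rewrite dvdn0 in pNi.
have /eqP := congr1 (fun g : {poly F} => g`_i) f'0.
rewrite coef_deriv coef0 -mulr_natr mulf_eq0 => /orP[/eqP //|].
by rewrite -(dvdn_pcharf pF) (negPf pNi).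
Qed.

Lemma deriv_comp_Xp (F : fieldType) (p : nat) (g : {poly F}) :
  p \in [pchar F] -> (g \Po 'X^p)^`() = 0.
Proof.
move=> pF; rewrite deriv_comp derivXn -mulr_natr -polyC_natr (pcharf0 pF).
by rewrite !mulr0.
Qed.

(** * Quotients by maximal ideals *)

Section MaximalIdeal.
Variables (R : comNzRingType) (M : idealr R).
Local Notation Q := {ideal_quot M}.
Local Notation pi := (\pi_Q)%qT.

Lemma pi_eq0 x : (pi x == 0) = (x \in M).
Proof. by rewrite -(rmorph0 pi) -Quotient.idealrBE subr0. Qed.

Hypothesis M_max : maximal_ideal M.

Lemma maximal_ideal_inv v : v \notin M -> exists w, 1 - v * w \in M.
Proof.
move=> vNM; apply: contrapT => no_inv.
(* This is M + vR. Without an inverse of [v] modulo M it misses 1, so it is a proper ideal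
   containing M and [v]. *)
pose S : {pred R} := fun x => `[< exists w, x - v * w \in M >].
have S_ideal : idealr_closed S.
  split.
  - by apply/asboolP; exists 0; rewrite mulr0 subrr rpred0.
  - by apply/asboolP.
  - move=> a x y /asboolP[w xM] /asboolP[w' yM]; apply/asboolP.
    exists (a * w + w'); rewrite mulrDr opprD addrACA mulrCA -mulrBr.
    by rewrite rpredD // idealMr.
pose I : idealr R := HB.pack S (isIdealr.Build R S S_ideal).
case/negP: vNM; apply: (M_max (I := I)).
  by move=> x xM; apply/asboolP; exists 0; rewrite mulr0 subr0.
by apply/asboolP; exists 1; rewrite mulr1 subrr rpred0.
Qed.

Lemma maximal_quot_reduced (k : nat) (y : Q) : y ^+ k = 0 -> y = 0.
Proof.
rewrite -[y]reprK; set v := repr y => yk0; apply/eqP; rewrite pi_eq0.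
apply/negPn/negP => /maximal_ideal_inv[w].
rewrite -pi_eq0 rmorphB rmorphM rmorph1 subr_eq0 => /eqP vw.
have /eqP : (1 : Q) ^+ k = 0 by rewrite vw exprMn yk0 mul0r.
by rewrite expr1n oner_eq0.
Qed.

End MaximalIdeal.

(** Splitting off one factor [e] would make [e] or the remaining power a unit; in both cases the
    whole power is a unit. *)
Lemma expn_not_irreducible_in (K : comNzRingType) (S : {pred K}) (k : nat)
    (e : K) :
  subring_closed S -> e \in S -> (1 < k)%N -> ~ irreducible_in S (e ^+ k).
Proof.
move=> [S1 _ SM] eS; case: k => [|[|k]] // _ [_ _ nonunit irr].
have eX i : e ^+ i \in S.
  by elim: i => [|i IHi]; rewrite ?expr0 // exprS SM.
apply: nonunit.
have [e_unit|ek_unit] := irr e (e ^+ k.+1) eS (eX _) (exprS _ _).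
  have [_ [b bS eb]] := e_unit; split=> //; exists (b ^+ k.+2).
    by elim: k.+2 => [|i IHi]; rewrite ?expr0 // exprS SM.
  by rewrite -exprMn eb expr1n.
have [_ [b bS ekb]] := ek_unit; split=> //; exists (e ^+ k * b ^+ 2).
  by rewrite !SM.
by rewrite mulrA -exprD addSnnS addnn -muln2 exprM -exprMn ekb expr1n.
Qed.

(** * Evaluation in the tower, units and irreducible elements *)

Section Tower.
Variables (p : nat) (F K : fieldType) (iota : {rmorphism F -> K}).
Variable X : root_tower p iota.
Hypothesis pF : p \in [pchar F].

Local Notation ev n g := ((map_poly iota g).[X n]).

Let xk n k : X n ^+ k != 0. Proof. by rewrite expf_neq0 ?tower_root_neq0. Qed.

Let pK : p \in [pchar K]. Proof. exact: (rmorph_pchar iota). Qed.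

Lemma tower_eval_inj n : injective (fun g => ev n g).
Proof.
move=> g h /eqP; rewrite -subr_eq0 -hornerN -hornerD -rmorphB => /eqP gh.
apply/eqP; rewrite -subr_eq0; apply/negPn/negP => gh0.
by apply: (@tower_root_transc _ _ _ _ X n); exists (g - h) => //; apply/rootP.
Qed.

Lemma tower_eval_Xn n k : ev n 'X^k = X n ^+ k.
Proof. by rewrite map_polyXn hornerXn. Qed.

Lemma tower_eval_M n g h : ev n (g * h) = ev n g * ev n h.
Proof. by rewrite rmorphM hornerM. Qed.

Lemma tower_eval_comp n g : ev n.+1 (g \Po 'X^p) = ev n g.
Proof.
by rewrite map_comp_poly map_polyXn horner_comp hornerXn tower_rootX.
Qed.

Lemma tower_eval_Frobenius n g :
  ev n.+1 g ^+ p = ev n (map_poly (pFrobenius_aut pF) g).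
Proof.
rewrite -[X n]tower_rootX -!(pFrobenius_autE pK) -horner_map -!map_poly_comp.
congr (_.[_]). apply: eq_map_poly => a /=.
by rewrite !pFrobenius_autE rmorphXn.
Qed.

Lemma tower_eval_in n g : ev n g \in Dn X n.
Proof. by apply/asboolP; exists g, 0%N; rewrite expr0 divr1. Qed.

Lemma Dn_mul n : {in Dn X n &, forall a b, a * b \in Dn X n}.
Proof. by case: (Dn_subring X n). Qed.

Lemma Dn_exp n k a : a \in Dn X n -> a ^+ k \in Dn X n.
Proof.
move=> aD; elim: k => [|k IHk]; last by rewrite exprS Dn_mul.
by case: (Dn_subring X n).
Qed.

Lemma Dn_expp n v : v \in Dn X n.+1 -> v ^+ p \in Dn X n.
Proof.
move=> /asboolP[g [k ->]]; apply/asboolP.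
exists (map_poly (pFrobenius_aut pF) g), k.
by rewrite exprMn exprVn -exprM mulnC exprM tower_rootX tower_eval_Frobenius.
Qed.

Lemma Dn_monomial_unit n c j k :
  c != 0 -> unit_in (Dn X n) (iota c * X n ^+ j / X n ^+ k).
Proof.
move=> c0.
have mon_in d i l : iota d * X n ^+ i / X n ^+ l \in Dn X n.
  apply/asboolP; exists (d *: 'X^i), l.
  by rewrite map_polyZ map_polyXn hornerZ hornerXn.
split=> //; exists (iota c^-1 * X n ^+ k / X n ^+ j) => //.
rewrite mulf_div mulrACA -rmorphM /= divff // rmorph1 mul1r [X n ^+ k * _]mulrC.
by rewrite divff // mulf_neq0.
Qed.

(** Extracting the full power of the variable leaves a numerator with nonzero constant term, so that
    equalities in D_n can be compared as polynomial identities. *)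
Lemma Dn_normal_form n v : v \in Dn X n -> v != 0 ->
  exists g j k, ~~ root g 0 /\ v = ev n g * X n ^+ j / X n ^+ k.
Proof.
move=> /asboolP[h [k ->]] v0; have [j [g]] := multiplicity_XsubC h 0.
have h0 : h != 0.
  by apply: contraNneq v0 => ->; rewrite rmorph0 horner0 mul0r.
rewrite h0 subr0 => /= rg ->; exists g, j, k; split=> //.
by rewrite tower_eval_M tower_eval_Xn.
Qed.

(** Clearing denominators turns [q] into a divisor of a power of the variable, to which it is
    coprime. *)
Lemma tower_eval_unit n q :
  unit_in (Dn X n) (ev n q) -> ~~ root q 0 -> size q = 1%N.
Proof.
case=> _ [_ /asboolP[h [k ->]] + ] rq.
move=> /(congr1 ( *%R^~ (X n ^+ k))); rewrite mulrA mulfVK // mul1r => qh.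
have {}qh : q * h = 'X^k.
  by apply: (@tower_eval_inj n); rewrite /= tower_eval_M tower_eval_Xn.
have : coprimep q 'X^k by rewrite coprimep_expr // coprimepX.
move=> /coprimepP/(_ q (dvdpp q)); rewrite -qh dvdp_mulIl -size_poly_eq1.
by move=> /(_ isT) /eqP.
Qed.

(** A nonzero constant term passes to both factors of [f], so a factor that is a unit in D_n is a
    constant. This gives access to unique factorization. *)
Lemma irreducible_in_poly n f : ~~ root f 0 ->
  irreducible_in (Dn X n) (ev n f) -> irreducible_poly f.
Proof.
move=> rf [_ f0 f_nonunit f_irr].
have fn0 : f != 0 by apply: contraNneq rf => ->; rewrite root0.
split.
  rewrite ltnNge; apply/negP => szf; apply: f_nonunit.
  have : size f == 1%N by rewrite eqn_leq szf lt0n size_poly_eq0.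
  move=> /size_poly1P[c c0 ->]; rewrite map_polyC hornerC /=.
  by have := @Dn_monomial_unit n c 0 0 c0; rewrite expr0 mulr1 divr1.
move=> q szq /dvdpP[r fE]; have := rf; rewrite fE rootM negb_or => /andP[rr rq].
have [] := f_irr _ _ (tower_eval_in n r) (tower_eval_in n q).
- by rewrite fE tower_eval_M.
- move=> /tower_eval_unit /(_ rr) /eqP /size_poly1P[c c0 ->].
  by rewrite mul_polyC eqp_sym eqp_scale.
- by move=> /tower_eval_unit /(_ rq) sz1; rewrite sz1 in szq.
Qed.

Lemma unit_in_expp n v : v \in Dn X n.+1 ->
  unit_in (Dn X n) (v ^+ p) -> unit_in (Dn X n.+1) v.
Proof.
move=> vD [_ [w wD vw]]; split=> //; exists (v ^+ p.-1 * w).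
  by rewrite Dn_mul ?Dn_exp // (Dn_mono (leqnSn n)).
by rewrite mulrA -exprS prednK // prime_gt0 // (pcharf_prime pF).
Qed.

(** The p-th powers of the factors of [v] lie in D_n and factor [v ^+ p]; units descend and lift by
    [unit_in_expp]. *)
Lemma irreducible_in_expp n v : v \in Dn X n.+1 ->
  irreducible_in (Dn X n) (v ^+ p) -> irreducible_in (Dn X n.+1) v.
Proof.
move=> vD [_ vp0 vp_nonunit vp_irr]; split=> //.
- apply: contraNneq vp0 => ->.
  by rewrite expr0n gtn_eqF // prime_gt0 // (pcharf_prime pF).
- move=> [_ [w wD vw]]; apply: vp_nonunit; split; first exact: Dn_expp.
  by exists (w ^+ p); [exact: Dn_expp | rewrite -exprMn vw expr1n].
- move=> b c bD cD vE.
  have bcp : v ^+ p = b ^+ p * c ^+ p by rewrite vE exprMn.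
  have [bu|cu] := vp_irr _ _ (Dn_expp bD) (Dn_expp cD) bcp.
    by left; exact: unit_in_expp.
  by right; exact: unit_in_expp.
Qed.

Lemma expp_irreducible_in n f : ~~ root f 0 -> ev n.+1 f \notin Dn X n ->
  irreducible_in (Dn X n.+1) (ev n.+1 f) ->
  irreducible_in (Dn X n) (ev n.+1 f ^+ p).
Proof.
move=> rf fND f_irr; have irr_f := irreducible_in_poly rf f_irr.
case: f_irr => fD f0 f_nonunit _.
have unit_factor q e j k : e != 0 -> q \Po 'X^p = e%:P ->
    unit_in (Dn X n) (ev n q * X n ^+ j / X n ^+ k).
  move=> e0 qE; rewrite -tower_eval_comp qE map_polyC hornerC.
  exact: Dn_monomial_unit.
split; first exact: Dn_expp.
- by rewrite expf_neq0.
- by move=> /(unit_in_expp fD).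
move=> b c bD cD bc.
have [b0 c0] : b != 0 /\ c != 0.
  by apply/andP; rewrite -negb_or -mulf_eq0 -bc expf_neq0.
have [g [j [k [rg bE]]]] := Dn_normal_form bD b0.
have [h [j' [k' [rh cE]]]] := Dn_normal_form cD c0.
have rcomp (q : {poly F}) : root (q \Po 'X^p) 0 = root q 0.
  rewrite !rootE horner_comp hornerXn expr0n gtn_eqF //.
  by rewrite prime_gt0 // (pcharf_prime pF).
(* Denominators are cleared at level [n.+1]; the monomials then cancel because no other factor
   vanishes at 0. *)
have ghE : (g \Po 'X^p) * (h \Po 'X^p) = f ^+ p.
  apply: (@mulXn_inj _ _ _ (p * (j + j')) (p * (k + k'))).
  - by rewrite rootM negb_or !rcomp rg.
  - by rewrite /root horner_exp expf_neq0.
  apply: (@tower_eval_inj n.+1) => /=.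
  rewrite !tower_eval_M !tower_eval_comp !tower_eval_Xn !exprM tower_rootX.
  rewrite rmorphXn horner_exp bc bE cE mulf_div [X n ^+ k * _]mulrC !exprD.
  rewrite [X n ^+ k' * _]mulrC mulfVK ?mulf_neq0 // mulrACA //.
have [i [d [le_ip d0 gE]]] := irreducible_dvd_exp irr_f ghE.
have [i0|i_gt0] := posnP i.
  by left; rewrite bE; apply: (unit_factor _ _ _ _ d0); rewrite gE i0 alg_polyC.
(* If [i = p], all of [f ^+ p] sits in [g], and the cofactor [h] is the constant [d^-1]. *)
move: le_ip; rewrite leq_eqVlt => /predU1P[ip|lt_ip].
  right; rewrite cE; apply: (unit_factor _ d^-1); first by rewrite invr_eq0.
  apply: (@scalerI _ _ d) => //; rewrite -[RHS]mul_polyC -polyCM divff //.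
  apply: (@mulIf _ (f ^+ p)); first by rewrite expf_neq0 ?irredp_neq0.
  by rewrite mul1r -scalerAl mulrC -{1}ip scalerAl -gE ghE.
(* Here [0 < i < p]. Differentiating [d *: f ^+ i], a polynomial in ['X^p], forces the derivative of
   [f] to vanish, so [f] itself would evaluate into D_n. *)
case/negP: fND; suff f'0 : f^`() = 0.
  by rewrite (deriv_eq0_comp_Xn pF f'0) tower_eval_comp tower_eval_in.
have := deriv_comp_Xp g pF; rewrite gE derivZ deriv_exp => /eqP.
rewrite scaler_eq0 (negPf d0) -mulr_natr -polyC_natr mulf_eq0 polyC_eq0 /=.
rewrite -(dvdn_pcharf pF) gtnNdvd // orbF mulf_eq0 expf_eq0.
by rewrite (negPf (irredp_neq0 irr_f)) andbF orbF => /eqP.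
Qed.

(** Taking p-th roots of the coefficients and replacing [X n] by [X n.+1] inverts Frobenius. *)
Lemma Dn_root n : (forall a : F, exists b, b ^+ p = a) ->
  forall d, d \in Dn X n -> exists2 e, e \in Dn X n.+1 & e ^+ p = d.
Proof.
move=> /choice[r rE] d /asboolP[g [k ->]].
pose h := \poly_(i < size g) r g`_i.
exists (ev n.+1 h / X n.+1 ^+ k); first by apply/asboolP; exists h, k.
rewrite exprMn exprVn -exprM mulnC exprM tower_rootX tower_eval_Frobenius.
congr ((map_poly iota _).[_] / _); apply/polyP=> i.
rewrite coef_map coef_poly; case: ltnP => [_|szi]; first exact: rE.
by rewrite [LHS]pFrobenius_aut0 nth_default.
Qed.

(** * Evaluation at 1 and its kernel *)

(* The graph of the evaluation of D at X^(1/p^n) = 1 for all n. *)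
Definition at1 (v : K) (c : F) : Prop :=
  exists n g k, v = ev n g / X n ^+ k /\ g.[1] = c.

Lemma at1_poly n g : at1 (ev n g) g.[1].
Proof. by exists n, g, 0%N; rewrite expr0 divr1. Qed.

Lemma at1_lift m n g k : exists h l,
  ev n g / X n ^+ k = ev (m + n)%N h / X (m + n)%N ^+ l /\ h.[1] = g.[1].
Proof.
elim: m => [|m [h [l [-> <-]]]]; first by exists g, k.
exists (h \Po 'X^p), (p * l)%N.
by rewrite addSn tower_eval_comp exprM tower_rootX horner_comp hornerXn expr1n.
Qed.

Lemma at1_common u v c d : at1 u c -> at1 v d -> exists n g h k l,
  [/\ u = ev n g / X n ^+ k, g.[1] = c, v = ev n h / X n ^+ l & h.[1] = d].
Proof.
move=> [m [g [k [-> <-]]]] [n [h [l [-> <-]]]].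
have [g' [k' [-> <-]]] := at1_lift n m g k.
have [h' [l' [-> <-]]] := at1_lift m n h l.
by rewrite addnC; exists (m + n)%N, g', h', k', l'.
Qed.

(** The value does not depend on the representation: at a common level, cross-multiplication gives a
    polynomial identity, to be evaluated at 1. *)
Lemma at1_inj v c d : at1 v c -> at1 v d -> c = d.
Proof.
move=> vc vd; have [n [g [h [k [l [-> <- /eqP + <-]]]]]] := at1_common vc vd.
rewrite eqr_div // -!tower_eval_Xn -!tower_eval_M => /eqP/tower_eval_inj.
by move=> /(congr1 (horner^~ 1)); rewrite !hornerM !hornerXn !expr1n !mulr1.
Qed.

Lemma at1M u v c d : at1 u c -> at1 v d -> at1 (u * v) (c * d).
Proof.
move=> uc vd; have [n [g [h [k [l [-> <- -> <-]]]]]] := at1_common uc vd.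
by exists n, (g * h), (k + l)%N; rewrite tower_eval_M hornerM exprD mulf_div.
Qed.

Lemma at1D u v c d : at1 u c -> at1 v d -> at1 (u + v) (c + d).
Proof.
move=> uc vd; have [n [g [h [k [l [-> <- -> <-]]]]]] := at1_common uc vd.
exists n, (g * 'X^l + h * 'X^k), (k + l)%N.
rewrite rmorphD hornerD !tower_eval_M !tower_eval_Xn hornerD !hornerM !hornerXn.
by rewrite !expr1n !mulr1 addf_div // exprD.
Qed.

Lemma Dunion_at1 v : v \in Dunion X -> exists c, at1 v c.
Proof. by move=> /asboolP[n /asboolP[g [k ->]]]; exists g.[1], n, g, k. Qed.

Definition aug_ideal : {pred Dring X} := fun v => `[< at1 (val v) 0 >].

Lemma at1_1 : at1 1 1.
Proof. by have := at1_poly 0 1; rewrite rmorph1 !hornerC. Qed.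

Lemma at1_0 : at1 0 0.
Proof. by have := at1_poly 0 0; rewrite rmorph0 !horner0. Qed.

Lemma aug_ideal_closed : idealr_closed aug_ideal.
Proof.
split.
- by apply/asboolP; rewrite rmorph0; exact: at1_0.
- apply/asboolP; rewrite rmorph1 => /(at1_inj at1_1) /eqP.
  by rewrite oner_eq0.
- move=> a u v /asboolP u0 /asboolP v0; apply/asboolP; rewrite rmorphD rmorphM.
  have [c ac] := Dunion_at1 (valP a).
  by have := at1D (at1M ac u0) v0; rewrite mulr0 addr0.
Qed.

HB.instance Definition _ := isIdealr.Build (Dring X) aug_ideal aug_ideal_closed.

(** * Polynomials in X inside D, and the residue fields of D *)

Lemma Dring_poly_in g : ev 0 g \in Dunion X.
Proof. by apply/asboolP; exists 0%N; exact: tower_eval_in. Qed.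

Definition Dring_poly g : Dring X := MkDring (Dring_poly_in g).

Lemma Dring_poly_zmod_morphism : zmod_morphism Dring_poly.
Proof. by move=> g h; apply: val_inj; rewrite /= !rmorphB hornerD hornerN. Qed.

Lemma Dring_poly_monoid_morphism : monoid_morphism Dring_poly.
Proof.
split=> [|g h]; apply: val_inj; first by rewrite /= !rmorph1 hornerC.
by rewrite /= !rmorphM hornerM.
Qed.

HB.instance Definition _ := GRing.isZmodMorphism.Build {poly F} (Dring X)
  Dring_poly Dring_poly_zmod_morphism.
HB.instance Definition _ := GRing.isMonoidMorphism.Build {poly F} (Dring X)
  Dring_poly Dring_poly_monoid_morphism.

Lemma pchar_Dring_quot (M : idealr (Dring X)) : p \in [pchar {ideal_quot M}].
Proof.
apply/andP; split; first exact: (pcharf_prime pF).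
rewrite -(rmorph_nat (\pi_({ideal_quot M})%qT)) pi_eq0.
rewrite (_ : p%:R = 0) ?rpred0 //.
by apply: val_inj; rewrite rmorph_nat rmorph0 (pcharf0 pK).
Qed.

Lemma Dn_expp_iter m v : v \in Dn X m -> v ^+ (p ^ m) \in Dn X 0.
Proof.
elim: m v => [|m IHm] v vD; first by rewrite expr1.
by rewrite expnS exprM IHm ?Dn_expp.
Qed.

Lemma Dring_val_X_inv : (X 0)^-1 \in Dunion X.
Proof.
by apply/asboolP; exists 0%N; apply/asboolP; exists 1, 1%N;
   rewrite rmorph1 hornerC expr1 div1r.
Qed.

(** Iterated Frobenius brings [v] down to D_0, where a power of X clears the denominator. *)
Lemma Dring_expp_poly (v : Dring X) : exists m g k,
  v ^+ (p ^ m) * Dring_poly 'X^k = Dring_poly g.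
Proof.
have /asboolP[m /Dn_expp_iter /asboolP[g [k vg]]] := valP v.
exists m, g, k; apply: val_inj.
by rewrite rmorphM rmorphXn /= vg tower_eval_Xn mulfVK.
Qed.

(** Either 1 - X lies in M, or it is invertible modulo M and [u = 1 - (1 - X) w] lies in M. The
    latter takes the value 1 at 1, hence is nonzero, and a power of it times a power of X is the
    polynomial sought. *)
Lemma maximal_ideal_poly (M : idealr (Dring X)) : maximal_ideal M ->
  exists2 g, g != 0 & Dring_poly g \in M.
Proof.
move=> M_max; pose g1 : {poly F} := 1 - 'X.
have g1_aug : Dring_poly g1 \in (aug_ideal : {pred Dring X}).
  apply/asboolP; have := at1_poly 0 g1.
  by rewrite !hornerE subrr.
have [g1M|/(maximal_ideal_inv M_max)[w g1wM]] := boolP (Dring_poly g1 \in M).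
  exists g1 => //; apply: contraTneq (oner_neq0 F) => g10.
  have := congr1 (horner^~ 0) g10.
  by rewrite !hornerE subr0 => ->; rewrite eqxx.
set u := 1 - _ in g1wM.
have u0 : u != 0.
  rewrite subr_eq0; apply/eqP => g1w.
  have := @idealr1 _ (aug_ideal : idealr (Dring X)).
  by rewrite g1w mulrC idealMr.
have [m [g [k ugE]]] := Dring_expp_poly u; exists g; last first.
  rewrite -ugE mulrC idealMr // -(prednK (_ : 0 < p ^ m)%N) ?exprSr ?idealMr //.
  by rewrite expn_gt0 prime_gt0 // (pcharf_prime pF).
apply: contraNneq u0 => g0; move/(congr1 val): ugE.
rewrite g0 rmorphM rmorphXn !rmorph0 /= tower_eval_Xn => /eqP.
rewrite mulf_eq0 (negPf (xk _ _)) orbF expf_eq0 => /andP[_ /eqP u0].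
by apply/eqP/val_inj; rewrite rmorph0; exact: u0.
Qed.

Lemma finite_residue_field (M : idealr (Dring X)) :
  finite_set [set: F] -> maximal_ideal M -> finite_set [set: {ideal_quot M}].
Proof.
move=> finF M_max; have [g g0 gM] := maximal_ideal_poly M_max.
pose pi : {rmorphism Dring X -> {ideal_quot M}} := (\pi_({ideal_quot M}))%qT.
pose psi : {rmorphism {poly F} -> {ideal_quot M}} := pi \o Dring_poly.
have finE : finite_set (range psi).
  by apply: (finite_range_poly finF g0); apply/eqP; rewrite /= pi_eq0.
have powE h i : range psi (psi h ^+ i) by exists (h ^+ i); rewrite ?rmorphXn.
have injp : injective (fun y : {ideal_quot M} => y ^+ p).
  apply: (Frobenius_inj (pchar_Dring_quot M)) => y.
  exact: maximal_quot_reduced M_max _ _.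
pose x' := MkDring Dring_val_X_inv.
have x'x : x' * Dring_poly 'X = 1.
  apply: val_inj; rewrite rmorphM rmorph1 /= map_polyX hornerX.
  by rewrite mulVf ?tower_root_neq0.
have zx : pi x' * psi 'X = 1.
  by have := congr1 pi x'x; rewrite rmorphM rmorph1.
(* The class of the inverse of X is a power of the class of X, so denominators stay inside the
   finite image. *)
have [i x'E] := finite_unit_inv finE (powE 'X) zx.
apply: (sub_finite_set _ finE) => y _; rewrite -[y]reprK; set v := repr y.
have [m [h [k vh]]] := Dring_expp_poly v.
have psi_h : psi h = pi v ^+ (p ^ m) * psi 'X ^+ k.
  by have := congr1 pi vh; rewrite rmorphM !rmorphXn.
have vE : pi v ^+ (p ^ m) = psi (h * 'X^(i * k)).
  rewrite rmorphM rmorphXn exprM -x'E psi_h -mulrA -exprMn.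
  by rewrite [psi _ * _]mulrC zx expr1n mulr1.
have [j vj] := finite_Frobenius_root injp finE (powE _) vE.
by change (range psi (pi v)); rewrite vj.
Qed.

(** If [v] in I had value [c != 0], then [c - v] would lie in the kernel, so I would contain the
    unit [c]. *)
Lemma aug_ideal_maximal : maximal_ideal (aug_ideal : idealr (Dring X)).
Proof.
move=> I sub_I v vI; apply/asboolP; have [c vc] := Dunion_at1 (valP v).
suff : c = 0 by move=> <-.
apply/eqP/negPn/negP => c0.
have cI : Dring_poly c%:P \in I.
  rewrite -[Dring_poly _](subrK v) rpredD // sub_I //; apply/asboolP.
  rewrite rmorphB -(subrr c); apply: at1D.
    by have := at1_poly 0 c%:P; rewrite hornerC.
  have := at1M (at1_poly 0 (-1)) vc; rewrite hornerN hornerC mulN1r.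
  by rewrite rmorphN rmorph1 hornerN hornerC mulN1r.
have := idealMr (Dring_poly c^-1%:P) cI.
by rewrite -rmorphM -polyCM mulVf // rmorph1 idealr1.
Qed.

Lemma finite_base_field :
  (forall M : idealr (Dring X), maximal_ideal M ->
     finite_set [set: {ideal_quot M}]) -> finite_set [set: F].
Proof.
move=> /(_ _ aug_ideal_maximal) finQ.
pose pi : {rmorphism Dring X -> {ideal_quot (aug_ideal : idealr (Dring X))}} :=
  (\pi_({ideal_quot (aug_ideal : idealr (Dring X))}))%qT.
pose s c := pi (Dring_poly c%:P).
rewrite (_ : [set: F] = s @^-1` setT) ?preimage_setT //.
apply: (finite_preimage (f := s)) finQ => c d _ _ eq_s.
have : pi (Dring_poly (c - d)%:P) == 0.
  by rewrite polyCB !rmorphB subr_eq0; apply/eqP.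
rewrite /pi pi_eq0 => /asboolP cd0.
(* A constant evaluates to itself, so a constant in the kernel is 0. *)
apply/eqP; rewrite -subr_eq0; apply/eqP; apply: at1_inj cd0.
by have := at1_poly 0 (c - d)%:P; rewrite hornerC.
Qed.

End Tower.

Theorem corollary3p11 (p : nat) (F K : fieldType) (iota : {rmorphism F -> K})
    (X : root_tower p iota) (n : nat) (f : {poly F}) :
  p \in [pchar F] ->
  (1 < size f)%N ->
  f.[0] != 0 ->
  let fX := (map_poly iota f).[X n.+1] in
  [/\ fX ^+ p \in Dn X n,
      fX \notin Dn X n ->
        (irreducible_in (Dn X n.+1) fX <-> irreducible_in (Dn X n) (fX ^+ p)),
      algebraic_over_Fp p F ->
        (forall d : K, d \in Dn X n -> d != 0 -> ~ unit_in (Dn X n) d ->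
           ~ irreducible_in (Dn X n.+1) d)
        /\ (forall d : K, ~ irreducible_in (Dunion X) d) &
      finite_set [set: F] <->
        (forall M : idealr (Dring X), maximal_ideal M ->
           finite_set [set: {ideal_quot M}])].
Proof.
move=> pF _ f0 fX; have fXD : fX \in Dn X n.+1 by exact: tower_eval_in.
split.
- exact: Dn_expp.
- move=> fXND; split; first exact: expp_irreducible_in.
  exact: irreducible_in_expp.
- move=> algF.
  have perfF a := algebraic_over_Fp_perfect pF (algF a).
  have root_ex m := @Dn_root _ _ _ _ X pF m perfF.
  have p_gt1 := prime_gt1 (pcharf_prime pF).
  split=> [d dD _ _|d d_irr].
    have [e eD <-] := root_ex _ _ dD.
    exact: expn_not_irreducible_in (Dn_subring X n.+1) eD p_gt1.
  have /asboolP[m dD] : d \in Dunion X by case: d_irr.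
  have [e eD eE] := root_ex _ _ dD; move: d_irr; rewrite -eE.
  apply: expn_not_irreducible_in (Dunion_subring X) _ p_gt1.
  (* The p-th root lives one level higher, but still in D. *)
  by apply/asboolP; exists m.+1.
- split; last exact: finite_base_field.
  by move=> finF M; exact: finite_residue_field.
Qed.
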